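(* Let $w_n$ be the number of weak-ordering chains in $\mathcal{WOC}(n)$ subject to the stopping condition $x_{i_1}\le x_{i_2}\le x_{i_3}$ with $i_1<i_2<i_3$. Then \[ w_n=\sum_{d=0}^{n-1}2^{n-1-d}e_{n,d}+\sum_{j=3}^{n}\sum_{d=0}^{j-3}2^{j-1-d}g_{j,d}. \] The sequence starts $1,3,13,59,269,1227,5613,25771,118765,\dots$, and $W(x)=\sum_{n\ge1}w_nx^n$ satisfies \[ 1+W(x)=\frac{x}{1-x^2}+\frac{1-2x-2x^2}{(1-x^2)\sqrt{1-4x-4x^2}}. \]
   Context: A weak-ordering chain on $x_1,\dots,x_m$ is an expression $x_{i_1}\,\mathrm{op}\,x_{i_2}\,\mathrm{op}\cdots\mathrm{op}\,x_{i_m}$, where $(i_1,\dots,i_m)$ is an ordering of $[m]$ and each $\mathrm{op}$ is $<$ or $=$; expressions defining the same ordered set partition of $[m]$ are identified. $\mathcal{WOC}(m)$ is the set of these chains. Each chain in $\mathcal{WOC}(m)$, $m\ge 2$, arises uniquely from its restriction to $x_1,\dots,x_{m-1}$ by inserting $x_m$; this gives a rooted tree with root $x_1$ whose level-$m$ nodes are the elements of $\mathcal{WOC}(m)$. The restricted generating tree of order $n$ for a stopping condition is the part of this tree up to level $n$ in which any node containing the stopping condition has no descendants; ''the number of weak-ordering chains in $\mathcal{WOC}(n)$ subject to the stopping condition'' is the number of leaves of this tree (nodes at level $n$ plus nodes containing the condition), equivalently the number of chains in $\mathcal{WOC}(n)$ avoiding the condition plus, for each $j\le n$, the number of chains in $\mathcal{WOC}(j)$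 containing the condition whose restriction to $x_1,\dots,x_{j-1}$ avoids it. Here a chain contains the stopping condition if there are indices $i_1<i_2<i_3$ such that $x_{i_1}\le x_{i_2}$ and $x_{i_2}\le x_{i_3}$ hold in the chain (each relation being $<$ or $=$). $e_{n,d}$ is the number of $123$-avoiding permutations of $[n]$ with exactly $d$ descents. $g_{j,d}=|\mathcal{G}^d_j(123)|$, where for $j>3$, $1\le d\le j-3$, $\mathcal{G}^d_j(123)$ is the set of permutations $\sigma$ of $[j]$ that contain the pattern $123$, have exactly $d$ descents, and such that the permutation obtained from $\sigma$ by deleting $j$ avoids $123$; $\mathcal{G}^0_3(123)=\{123\}$, and $g_{j,d}=0$ otherwise. *)

(* Defs.v *)
From HB Require Import structures.
From mathcomp Require Import all_boot all_order all_algebra all_fingroup.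
From mathcomp Require Import boolp.

Set Implicit Arguments.
Unset Strict Implicit.
Unset Printing Implicit Defensive.

Import GRing.Theory.

(* Indices are shifted by one: x_(i+1) is represented by i : 'I_m. *)

(** * Weak-ordering chains *)

(* A chain is the ordered set partition B_1, ..., B_k that it defines: the
   x_i with i in the same block are joined by =, and those of B_a are < those
   of B_b for a < b.  An ordered set partition of 'I_m has at most m blocks,
   so m.-bseq only serves to make the set of chains finite. *)
Definition WOC (m : nat) : {set m.-bseq {set 'I_m}} :=
  [set c : m.-bseq {set 'I_m} |
     uniq c && partition [set B in (c : seq {set 'I_m})] [set: 'I_m]].

Definition block_index (m : nat) (c : seq {set 'I_m}) (i : 'I_m) : nat :=
  find (fun B : {set 'I_m} => i \in B) c.

Definition chain_le (m : nat) (c : seq {set 'I_m}) (i j : 'I_m) : bool :=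
  block_index c i <= block_index c j.

(* Restriction to x_1, ..., x_(m-1); a block {x_m} disappears. *)
Definition restrict (m : nat) (c : seq {set 'I_m.+1}) : seq {set 'I_m} :=
  [seq B <- [seq [set i : 'I_m | widen_ord (leqnSn m) i \in A] | A : {set 'I_m.+1} <- c]
     | B != set0].

Definition stopping_condition := forall m : nat, seq {set 'I_m} -> bool.

(* c is a node of the generating tree rooted at the chain x_1, pruned so that
   nodes satisfying stop have no descendants. *)
Fixpoint in_restricted_tree (stop : stopping_condition) (m : nat) :
    seq {set 'I_m} -> bool :=
  match m return seq {set 'I_m} -> bool with
  | 0 => fun _ => false
  | m'.+1 => fun c =>
      (m' == 0) || (in_restricted_tree stop (restrict c)
                    && ~~ stop m' (restrict c))
  end.

(* The leaves of the generating tree restricted to the levels 1, ..., n: the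
   nodes of level n and the nodes satisfying stop. *)
Definition num_chains (stop : stopping_condition) (n : nat) : nat :=
  \sum_(1 <= m < n.+1)
     #|[set c in WOC m | in_restricted_tree stop c & (m == n) || stop m c]|.

Definition stop_le_le : stopping_condition := fun m c =>
  [exists i1 : 'I_m, exists i2 : 'I_m, exists i3 : 'I_m,
     [&& i1 < i2, i2 < i3, chain_le c i1 i2 & chain_le c i2 i3]].

Definition w (n : nat) : nat := num_chains stop_le_le n.

(** * Permutations, pattern 123 and descents *)

Definition oneline (n : nat) (s : 'S_n) : seq nat :=
  [seq (s i : nat).+1 | i <- enum 'I_n].

Definition contains123 (u : seq nat) : bool :=
  [exists i : 'I_(size u), exists j : 'I_(size u), exists k : 'I_(size u),
     [&& i < j, j < k, nth 0 u i < nth 0 u j & nth 0 u j < nth 0 u k]].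

Definition descents (u : seq nat) : nat :=
  #|[set i : 'I_(size u).-1 | nth 0 u i > nth 0 u i.+1]|.

Definition e (n d : nat) : nat :=
  #|[set s : 'S_n | ~~ contains123 (oneline s) & descents (oneline s) == d]|.

Definition G (j d : nat) : {set 'S_j} :=
  if (3 < j) && (1 <= d <= j - 3) then
    [set s : 'S_j | [&& contains123 (oneline s), descents (oneline s) == d
                      & ~~ contains123 (rem j (oneline s))]]
  else if (j == 3) && (d == 0) then [set 1%g]
  else set0.

Definition g (j d : nat) : nat := #|G j d|.

(** * Formal power series over the rationals *)

Local Open Scope ring_scope.

Record fps := FPS { fps_coef :> nat -> rat }.

Lemma fpsP (a b : fps) : (forall n, a n = b n) -> a = b.
Proof. by case: a b => [a] [b] /= ab; congr FPS; apply/funext. Qed.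

HB.instance Definition _ := gen_eqMixin fps.
HB.instance Definition _ := gen_choiceMixin fps.

Definition fps_zero := FPS (fun _ => 0).
Definition fps_one := FPS (fun n => (n == 0)%:R).
Definition fps_opp (a : fps) := FPS (fun n => - a n).
Definition fps_add (a b : fps) := FPS (fun n => a n + b n).
Definition fps_mul (a b : fps) := FPS (fun n => \sum_(i < n.+1) a i * b (n - i)%N).

Fact fps_addA : associative fps_add.
Proof. by move=> a b c; apply: fpsP => n /=; rewrite addrA. Qed.
Fact fps_addC : commutative fps_add.
Proof. by move=> a b; apply: fpsP => n /=; rewrite addrC. Qed.
Fact fps_add0 : left_id fps_zero fps_add.
Proof. by move=> a; apply: fpsP => n /=; rewrite add0r. Qed.
Fact fps_addN : left_inverse fps_zero fps_opp fps_add.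
Proof. by move=> a; apply: fpsP => n /=; rewrite addNr. Qed.

HB.instance Definition _ :=
  GRing.isZmodule.Build fps fps_addA fps_addC fps_add0 fps_addN.

Definition fps_trunc (N : nat) (a : fps) : {poly rat} := \poly_(i < N.+1) a i.

Fact coef_fps_trunc N a i : (i <= N)%N -> (fps_trunc N a)`_i = a i.
Proof. by move=> iN; rewrite coef_poly ltnS iN. Qed.

Fact fps_mul_trunc N a b n : (n <= N)%N ->
  fps_mul a b n = (fps_trunc N a * fps_trunc N b)`_n.
Proof.
move=> nN; rewrite coefM /=; apply: eq_bigr => i _.
by rewrite !coef_fps_trunc ?(leq_trans _ nN) ?leq_subr // -ltnS.
Qed.

Fact fps_mulC : commutative fps_mul.
Proof.
by move=> a b; apply: fpsP => n; rewrite !(@fps_mul_trunc n) // mulrC.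
Qed.

Fact fps_mulA : associative fps_mul.
Proof.
move=> a b c; apply: fpsP => n.
transitivity ((fps_trunc n a * (fps_trunc n b * fps_trunc n c))`_n).
  rewrite coefM /=; apply: eq_bigr => i _.
  by rewrite -[X in _ * X]/(fps_mul b c _) (@fps_mul_trunc n) ?leq_subr //
             coef_fps_trunc // -ltnS.
rewrite mulrA coefM /=; apply: eq_bigr => i _.
rewrite (@coef_fps_trunc n c) ?leq_subr //; congr (_ * _).
by rewrite -(fps_mul_trunc a b (leq_ord i)).
Qed.

Fact fps_mul1 : left_id fps_one fps_mul.
Proof.
move=> a; apply: fpsP => n /=.
rewrite big_ord_recl big1 => [|i _]; last by rewrite mul0r.
by rewrite mul1r addr0 /= subn0.
Qed.

Fact fps_mulDl : left_distributive fps_mul fps_add.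
Proof.
move=> a b c; apply: fpsP => n /=; rewrite -big_split /=.
by apply: eq_bigr => i _; rewrite mulrDl.
Qed.

Fact fps_one_neq0 : fps_one != fps_zero.
Proof. by apply/eqP => /(congr1 (fun a : fps => a 0%N)). Qed.

HB.instance Definition _ := GRing.Zmodule_isComNzRing.Build fps
  fps_mulA fps_mulC fps_mul1 fps_mulDl fps_one_neq0.

(* The series whose n-th coefficient is step applied to the list of its n
   previous coefficients. *)
Fixpoint fps_prefix (step : seq rat -> rat) (n : nat) : seq rat :=
  if n is n'.+1 then
    let s := fps_prefix step n' in rcons s (step s)
  else [::].

Definition fps_rec (step : seq rat -> rat) :=
  FPS (fun n => step (fps_prefix step n)).

Fact size_fps_prefix step n : size (fps_prefix step n) = n.
Proof. by elim: n => //= n IH; rewrite size_rcons IH. Qed.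

Fact nth_fps_prefix step n i : (i < n)%N ->
  (fps_prefix step n)`_i = fps_rec step i.
Proof.
elim: n => // n IH; rewrite ltnS leq_eqVlt /= nth_rcons size_fps_prefix.
by case/predU1P => [->|lt_in]; [rewrite ltnn eqxx | rewrite lt_in IH].
Qed.

Definition fps_unit : pred fps := fun a => a 0%N != 0.

Definition fps_inv (a : fps) : fps :=
  if fps_unit a then
    fps_rec (fun s => ((size s == 0)%:R
       - \sum_(i < size s) s`_i * a (size s - i)%N) / a 0%N)
  else a.

Fact fps_mulV : {in fps_unit, left_inverse 1 fps_inv *%R}.
Proof.
move=> a ua; have a0 : a 0%N != 0 := ua.
apply: fpsP => n; rewrite -[LHS]/(fps_mul _ _ _) /= big_ord_recr /= subnn.
rewrite /fps_inv (_ : fps_unit a = true) //.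
set st := (X in fps_rec X).
rewrite [X in _ + X * _]/= {2}/st size_fps_prefix divfK //.
rewrite [X in _ + (_ - X)](eq_bigr (fun i : 'I_n => fps_rec st i * a (n - i)%N)).
  by rewrite addrC subrK.
by move=> i _; rewrite nth_fps_prefix.
Qed.

Fact fps_unitPl (a b : fps) : b * a = 1 -> fps_unit a.
Proof.
move=> /(congr1 (fun c : fps => c 0%N)).
rewrite -[LHS]/(fps_mul _ _ _) /= big_ord1 /fps_unit => ba1.
by apply/eqP => a0; move/eqP: ba1; rewrite a0 mulr0 eq_sym oner_eq0.
Qed.

Fact fps_inv_out : {in [predC fps_unit], fps_inv =1 id}.
Proof. by move=> a; rewrite /fps_inv inE => /negPf; rewrite -topredE /= => ->. Qed.

HB.instance Definition _ := GRing.ComNzRing_hasMulInverse.Build fps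
  fps_mulV fps_unitPl fps_inv_out.

Definition fpsX : fps := FPS (fun n => (n == 1)%:R).

(* The square root with constant term 1 of a series with constant term 1. *)
Definition fps_sqrt (a : fps) : fps :=
  fps_rec (fun s => if size s is n.+1 then
     (a n.+1 - \sum_(1 <= i < n.+1) s`_i * s`_(n.+1 - i)) / 2 else 1).

Lemma fps_sqrt_coef0 (a : fps) : fps_sqrt a 0%N = 1.
Proof. by []. Qed.

Lemma sqr_fps_sqrt (a : fps) : a 0%N = 1 -> fps_sqrt a ^+ 2 = a.
Proof.
move=> a0; have := fps_sqrt_coef0 a.
have rS n : fps_sqrt a n.+1 = (a n.+1 - \sum_(0 <= i < n)
            fps_sqrt a i.+1 * fps_sqrt a (n.+1 - i.+1)%N) / 2.
  rewrite {1}/fps_sqrt; set st := (X in fps_rec X).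
  rewrite -[LHS]/(st (fps_prefix st n.+1)) {1}/st size_fps_prefix big_add1.
  congr ((_ - _) / _); rewrite big_nat_cond [RHS]big_nat_cond.
  apply: eq_bigr => i; rewrite andbT => /andP[_ lt_in].
  by rewrite !nth_fps_prefix // subSS ltnS leq_subr.
move: (fps_sqrt a) rS => r rS r0; apply: fpsP => n.
rewrite expr2 -[LHS]/(fps_mul _ _ _) [LHS]/=.
case: n => [|n]; first by rewrite big_ord1 r0 mulr1 a0.
rewrite -(big_mkord predT (fun i => r i * r (n.+1 - i)%N)).
rewrite big_nat_recl // big_nat_recr //= subnn r0 mulr1 mul1r.
by rewrite rS addrCA -mulrDl -mulr2n -[X in X / 2]mulr_natr mulfK // addrC subrK.
Qed.

Definition W : fps := FPS (fun n => if (0 < n)%N then (w n)%:R else 0).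

(* Main.v *)
(* Write every block of a chain in increasing order: a chain becomes a
   permutation together with a set of ascents carrying "=", and the stopping
   condition becomes the pattern 123.  Grouping by descents gives the first
   formula.  A 123-avoiding word of length n with a ascents represents 2^a chains,
   and inserting n + 1 into it gives words representing 2^a (2n + 1 - a) chains;
   hence w_(n+1) - w_n is the sum of 2^a (2n - a), which is twice the total number
   of blocks of the avoiding chains of level n.

   For those, read an avoiding word from left to right, and let r be the number
   of unused values above the current minimum.  Both a singleton block and a
   two-element block change r to an arbitrary r' >= r - 1, each in exactly one
   way, so the numbers of blocks k and of indices n contribute independently:
   there are Cat_k * C(k, n - k) avoiding chains with k blocks.  Their generating
   function is the Catalan series composed with x + x^2. *)
Require Import Defs.
From mathcomp Require Import all_boot all_order all_algebra all_fingroup.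
From mathcomp Require Import zify ring.

Set Implicit Arguments.
Unset Strict Implicit.
Unset Printing Implicit Defensive.

Import GRing.Theory.

(** * Words: ascents, descents and the pattern 123 *)

(** The default 0 of [head] makes the last letter contribute no ascent. *)
Fixpoint asc (u : seq nat) : nat :=
  if u is x :: u' then (x < head 0 u') + asc u' else 0.

(* [inc2 m u]: m followed by u contains a 123 starting at m. *)
Fixpoint inc2 (m : nat) (u : seq nat) : bool :=
  if u is x :: u' then (m < x) && has (ltn x) u' || inc2 m u' else false.

Fixpoint inc3 (u : seq nat) : bool :=
  if u is x :: u' then inc2 x u' || inc3 u' else false.

Lemma inc2P m u :
  reflect (exists j k, [/\ j < k, k < size u, m < nth 0 u j & nth 0 u j < nth 0 u k])
          (inc2 m u).
Proof.
elim: u => [|x u IH] /=; first by apply: ReflectF => -[j [k []]]; lia.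
apply: (iffP orP) => [[/andP[mx /hasP[z /(nthP 0)[k ku <-] xz]]|/IH[j [k [jk ku mj jk']]]]|].
- by exists 0, k.+1.
- by exists j.+1, k.+1.
case=> -[|j] [[|k] [//= jk ku mj jk']].
  by left; rewrite mj; apply/hasP; exists (nth 0 u k); rewrite ?mem_nth.
by right; apply/IH; exists j, k.
Qed.

Lemma contains123E u : contains123 u = inc3 u.
Proof.
apply/existsP/idP => [[i /existsP[j /existsP[k /and4P[]]]]|].
  case: i => i /= iu; case: j => j /= ju; case: k => k /= ku ij jk.
  elim: u i j k iu ju ku ij jk => //= x u IH [|i] [|j] [|k] //= iu ju ku ij jk ij' jk'.
    by apply/orP; left; apply/inc2P; exists j, k.
  by apply/orP; right; apply: (IH i j k).
have: inc3 u -> exists i j k, [/\ i < j, j < k, k < size u,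
                                nth 0 u i < nth 0 u j & nth 0 u j < nth 0 u k].
  elim: u => //= x u IH /orP[/inc2P[j [k [jk ku xj jk']]]|/IH[i [j [k [ij jk ku ij' jk']]]]].
    by exists 0, j.+1, k.+1.
  by exists i.+1, j.+1, k.+1.
move=> /[apply] -[i [j [k [ij jk ku ij' jk']]]].
have ju := ltn_trans jk ku; have iu := ltn_trans ij ju.
exists (Ordinal iu); apply/existsP; exists (Ordinal ju); apply/existsP; exists (Ordinal ku).
by apply/and4P.
Qed.

Lemma inc2_filter a m u : inc2 m (filter a u) -> inc2 m u.
Proof.
elim: u => //= x u IH; case: ifP => _ /= => [/orP[/andP[-> /hasP[z]]|/IH->]|/IH->]; rewrite ?orbT //.
by rewrite mem_filter => /andP[_ zu] xz; apply/orP; left; apply/hasP; exists z.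
Qed.

Lemma inc3_filter a u : inc3 (filter a u) -> inc3 u.
Proof.
elim: u => //= x u IH; case: ifP => _ /= => [/orP[/inc2_filter->//|/IH->]|/IH->]; exact: orbT.
Qed.

Lemma inc2_leq m m' u : m <= m' -> inc2 m' u -> inc2 m u.
Proof.
move=> mm'; elim: u => //= x u IH /orP[/andP[m'x ->]|/IH->]; last exact: orbT.
by rewrite (leq_ltn_trans mm' m'x).
Qed.

Lemma asc_gt0 m u : has (ltn m) u -> 0 < asc (m :: u).
Proof.
elim: u m => //= y u IH m /orP[->//|mu].
have [my|ym] := ltnP m y; first by [].
by rewrite add0n IH //; apply: sub_has mu => z /=; apply: leq_ltn_trans.
Qed.

Lemma inc2_asc_gt0 m u : inc2 m u -> 0 < asc u.
Proof.
elim: u => //= x u IH /orP[/andP[_ /asc_gt0//]|/IH]; exact: ltn_addl.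
Qed.

Lemma inc2_asc m u : inc2 m u -> 1 < asc (m :: u).
Proof.
elim: u m => //= y u IH m.
have [my|ym] := ltnP m y; last by rewrite add0n /=; move=> /(inc2_leq ym)/IH.
move=> /orP[/asc_gt0|/inc2_asc_gt0 h]; first by rewrite add1n ltnS.
by rewrite add1n ltnS ltn_addl.
Qed.

(** An occurrence of 123 forces an ascent between its first two letters and another between its last
    two. Through [descents_asc] this yields the bound [j - 3] on descents. *)
Lemma inc3_asc u : inc3 u -> 1 < asc u.
Proof. by elim: u => //= x u IH /orP[/inc2_asc//|/IH]; apply: ltn_addl. Qed.

Lemma asc_bigE u : asc u = \sum_(i < (size u).-1) (nth 0 u i < nth 0 u i.+1).
Proof.
elim: u => [|x [|y u] IH]; rewrite ?big_ord0 //.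
by rewrite big_ord_recl -[LHS]/((x < y) + asc (y :: u)) IH.
Qed.

Lemma descents_asc u : uniq u -> descents u + asc u = (size u).-1.
Proof.
move=> uu; rewrite asc_bigE /descents -sum1_card big_mkcond /= -big_split /=.
rewrite -[RHS]card_ord -sum1_card; apply: eq_bigr => i _; rewrite inE.
have iu : i.+1 < size u by rewrite -ltn_predRL.
by case: ltngtP => // /eqP; rewrite nth_uniq // ?(ltnW iu) // => /eqP; lia.
Qed.

(** * One-line words of permutations *)

Lemma oneline_perms n (s : 'S_n) : oneline s \in permutations (iota 1 n).
Proof.
rewrite mem_permutations perm_sym.
have -> : oneline s = [seq i.+1 | i <- [seq val (s i) | i <- enum 'I_n]].
  by rewrite -map_comp.
rewrite -[iota 1 n]/(iota (1 + 0) n) iotaDl; apply/perm_map.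
rewrite perm_sym -(val_enum_ord n) (map_comp val s); apply: perm_map.
apply: uniq_perm; rewrite ?enum_uniq ?(map_inj_uniq (@perm_inj _ s)) ?enum_uniq //.
move=> i; rewrite mem_enum; apply/mapP; exists (s^-1 i)%g; by rewrite ?mem_enum ?permKV.
Qed.

Lemma oneline_inj n : injective (@oneline n).
Proof.
move=> s t st; apply/permP => i; apply/val_inj/succn_inj.
by have /eq_in_map/(_ i (mem_enum _ _)) := st.
Qed.

Lemma perm_oneline n :
  perm_eq [seq oneline s | s <- enum 'S_n] (permutations (iota 1 n)).
Proof.
have us : uniq [seq oneline s | s <- enum 'S_n].
  by rewrite (map_inj_uniq (@oneline_inj n)) enum_uniq.
apply: uniq_perm; rewrite ?permutations_uniq //.
apply: (uniq_min_size us _ _).2 => [t /mapP[s _ ->]|]; first exact: oneline_perms.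
by rewrite size_map size_permutations ?iota_uniq // size_iota -cardE card_Sn.
Qed.

Lemma card_oneline n (P : pred (seq nat)) :
  #|[set s : 'S_n | P (oneline s)]| = \sum_(u <- permutations (iota 1 n) | P u) 1.
Proof.
rewrite -(perm_big _ (perm_oneline n)) big_map /= -sum1_card.
rewrite [RHS](_ : _ = \sum_(s <- enum 'S_n | P (oneline s)) 1) //.
by rewrite big_enum_cond /=; apply: eq_bigl => s; rewrite !inE.
Qed.

(** * Chains as words cut into increasing blocks *)

(** The chains with flattened word [u]: each ascent is independently read as [<] (a cut) or [=] (no
    cut), and every other place is cut. *)
Fixpoint splits (u : seq nat) : seq (seq (seq nat)) :=
  if u is x :: u' then
    [seq [:: x] :: ss | ss <- splits u'] ++
    (if x < head 0 u' then [seq (x :: head [::] ss) :: behead ss | ss <- splits u']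
     else [::])
  else [:: [::]].

Lemma size_splits u : size (splits u) = 2 ^ asc u.
Proof.
elim: u => //= x u IH; rewrite size_cat size_map.
by case: ifP => _; rewrite ?size_map IH ?addn0 ?add0n // add1n expnS mul2n addnn.
Qed.

Lemma mem_splits u ss :
  (ss \in splits u) = [&& flatten ss == u, all (sorted ltn) ss & [::] \notin ss].
Proof.
elim: u ss => [|x u IH] ss /=.
  by rewrite inE; case: ss => [|[|y b] ss] //=; rewrite ?inE ?eqxx ?andbF.
rewrite mem_cat; apply/orP/idP.
  case=> [/mapP[tt]|].
    by rewrite IH => /and3P[/eqP ft st et] ->; rewrite /= ft eqxx st inE /= et.
  case: ifP => // xu /mapP[tt]; rewrite IH => /and3P[/eqP ft].
  case: tt ft => [|b tt] /=; first by move=> fu; rewrite -fu in xu.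
  move=> ft /andP[sb st]; rewrite inE negb_or => /andP[eb et] ->.
  rewrite /= ft eqxx st inE /= et !andbT.
  by case: b sb ft eb => [|y b] //= -> fu _; rewrite -fu /= in xu; rewrite xu.
case: ss => [|[|y [|z b]] ss] //=; rewrite ?inE ?eqxx ?andbF //=.
  move=> /and3P[/eqP[-> ft] st et]; left; apply: map_f.
  by rewrite IH ft eqxx st.
move=> /and3P[/eqP[-> ft] /andP[/andP[xz sb] st] et]; right.
have -> : head 0 u = z by rewrite -ft.
rewrite xz; apply/mapP; exists ((z :: b) :: ss) => //.
by rewrite IH /= ft eqxx sb st inE.
Qed.

Lemma uniq_splits u : uniq (splits u).
Proof.
elim: u => //= x u IH; rewrite cat_uniq map_inj_uniq ?IH /=; last by move=> ? ? [].
case: ifP => // xu.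
(* The ascent at [x] makes [u] nonempty, so every cut has a first block and joining [x] to it is
   injective. *)
have nz ss : ss \in splits u -> exists y b tt, ss = (y :: b) :: tt.
  rewrite mem_splits => /and3P[/eqP fs _].
  case: ss fs => [fu|[|y b] tt]; first by rewrite -fu in xu.
    by rewrite inE.
  by exists y, b, tt.
rewrite map_inj_in_uniq ?IH ?andbT; last first.
  by move=> s t /nz[y [b [s' ->]]] /nz[z [c [t' ->]]] [-> -> ->].
apply/hasPn => ss /mapP[s /nz[y [b [s' ->]]] ->]; apply/mapP => -[t _ //].
Qed.

Definition chain_words n := [seq ss | t <- permutations (iota 1 n), ss <- splits t].

Lemma mem_chain_words n ss : (ss \in chain_words n) =
  [&& perm_eq (flatten ss) (iota 1 n), all (sorted ltn) ss & [::] \notin ss].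
Proof.
apply/allpairsPdep/idP => [[t [s [tp sp ->]]]|/and3P[fs st nz]].
  rewrite mem_permutations in tp; move: sp; rewrite mem_splits.
  by move=> /and3P[/eqP-> -> ->]; rewrite tp.
exists (flatten ss), ss; split=> //; first by rewrite mem_permutations.
by rewrite mem_splits eqxx st.
Qed.

Lemma uniq_chain_words n : uniq (chain_words n).
Proof.
apply: allpairs_uniq_dep => [|t _|]; [exact: permutations_uniq | exact: uniq_splits | ].
move=> _ _ /allpairsPdep[t [s [_ sp ->]]] /allpairsPdep[t' [s' [_ sp' ->]]] /= ss'.
move: sp sp'; rewrite ss' !mem_splits => /and3P[/eqP <- _ _] /and3P[/eqP <- _ _].
by [].
Qed.

(** * Ordered set partitions coded as lists of increasing words *)

Section Coding.
Variable m : nat.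
Implicit Types (B : {set 'I_m}) (c : seq {set 'I_m}).

Definition block_word B : seq nat := [seq (val i).+1 | i <- enum B].
Definition chain_word c := [seq block_word B | B <- c].
Definition word_block (b : seq nat) : {set 'I_m} := [set i : 'I_m | i.+1 \in b].

Lemma mem_block_word B (i : 'I_m) : (i.+1 \in block_word B) = (i \in B).
Proof.
apply/mapP/idP => [[j]|iB]; last by exists i; rewrite ?mem_enum.
by rewrite mem_enum => jB [/val_inj->].
Qed.

Lemma block_wordK : cancel block_word word_block.
Proof. by move=> B; apply/setP => i; rewrite inE mem_block_word. Qed.

Lemma block_word_sorted B : sorted ltn (block_word B).
Proof.
apply: (subseq_sorted ltn_trans (s2 := iota 1 m)); last exact: iota_ltn_sorted.
have -> : iota 1 m = [seq (val i).+1 | i <- enum 'I_m].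
  by rewrite (map_comp S val) val_enum_ord -(iotaDl 1 0).
by apply: map_subseq; rewrite [X in subseq _ X]enumT; apply: filter_subseq.
Qed.

Lemma block_word_range B k : k \in block_word B -> k \in iota 1 m.
Proof. by move=> /mapP[i _ ->]; rewrite mem_iota /=; have := ltn_ord i; lia. Qed.

Lemma word_blockK b : sorted ltn b -> {subset b <= iota 1 m} ->
  block_word (word_block b) = b.
Proof.
move=> sb br; apply: (irr_sorted_eq ltn_trans ltnn) => //; first exact: block_word_sorted.
move=> k; apply/idP/idP => [|kb].
  by move=> /mapP[i]; rewrite mem_enum inE => ib ->.
have := br _ kb; rewrite mem_iota; case: k kb => // k kb; rewrite add1n /= ltnS => km.
by rewrite (mem_block_word _ (Ordinal km)) inE.
Qed.

Lemma block_word_eq0 B : (block_word B == [::]) = (B == set0).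
Proof. by rewrite -size_eq0 size_map -cardE cards_eq0. Qed.

Lemma nil_chain_word c : ([::] \in chain_word c) = (set0 \in c).
Proof.
apply/mapP/idP => [[B Bc /esym/eqP]|c0]; first by rewrite block_word_eq0 => /eqP<-.
by exists set0 => //; apply/esym/eqP; rewrite block_word_eq0.
Qed.

Lemma chain_word_sorted c : all (sorted ltn) (chain_word c).
Proof. by apply/allP => _ /mapP[B _ ->]; apply: block_word_sorted. Qed.

Lemma size_flatten_chain_word c : size (flatten (chain_word c)) = \sum_(B <- c) #|B|.
Proof.
elim: c => [|B c IH]; first by rewrite big_nil.
by rewrite big_cons /= size_cat IH size_map -cardE.
Qed.

Lemma uniq_flatten_nil (T : eqType) (ss : seq (seq T)) :
  uniq (flatten ss) -> [::] \notin ss -> uniq ss.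
Proof.
elim: ss => //= b ss IH; rewrite cat_uniq => /and3P[_ bs us].
rewrite inE negb_or => /andP[nb ns]; rewrite IH // andbT.
case: b nb bs => // x b _ /hasPn bs; apply/negP => bss.
have /bs : x \in flatten ss by apply/flattenP; exists (x :: b); rewrite ?mem_head.
by rewrite /= mem_head.
Qed.

Definition is_chain c := uniq c && partition [set B in c] [set: 'I_m].

Lemma flatten_chain_word_cover c :
  (cover [set B in c] == [set: 'I_m]) = all [in flatten (chain_word c)] (iota 1 m).
Proof.
rewrite eqEsubset subsetT /=; apply/subsetP/allP => [cov k|cov i _].
  rewrite mem_iota; case: k => // k; rewrite add1n /= ltnS => km.
  have /bigcupP[B] := cov (Ordinal km) (in_setT _); rewrite inE => Bc iB.
  by apply/flattenP; exists (block_word B); rewrite ?map_f // (mem_block_word _ (Ordinal km)).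
have /flattenP[_ /mapP[B Bc ->]] : i.+1 \in flatten (chain_word c).
  by apply: cov; rewrite mem_iota /= add1n ltnS.
by rewrite mem_block_word => iB; apply/bigcupP; exists B; rewrite ?inE.
Qed.

(** [trivIset] compares the sum of the block sizes with the size of the cover. Disjoint blocks
    covering all [m] points thus amount to a word of length [m] that hits all [m] values, which is a
    permutation. *)
Lemma is_chainE c : is_chain c = (chain_word c \in chain_words m).
Proof.
rewrite mem_chain_words chain_word_sorted nil_chain_word /=.
rewrite /is_chain /partition flatten_chain_word_cover /trivIset inE.
set f := flatten _.
have fr : {subset f <= iota 1 m}.
  by move=> k /flattenP[_ /mapP[B _ ->]]; apply: block_word_range.
have sumE : uniq c -> \sum_(B in [set B in c]) #|B| = size f.
  move=> uc; rewrite size_flatten_chain_word [RHS]big_uniq //=.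
  by apply: eq_bigl => B; rewrite inE.
apply/idP/idP.
  case/and4P=> uc /allP cov; rewrite sumE //.
  have -> : cover [set B in c] = setT.
    by apply/eqP; rewrite flatten_chain_word_cover; apply/allP.
  rewrite cardsT card_ord => /eqP sf ->; rewrite andbT.
  have ir := iota_uniq 1 m.
  have sz : size f <= size (iota 1 m) by rewrite size_iota sf.
  have fi := (uniq_min_size ir cov sz).2.
  by apply: uniq_perm => //; rewrite -(eq_uniq _ fi) ?size_iota ?sf.
case/andP=> pf c0; have uf : uniq f by rewrite (perm_uniq pf) iota_uniq.
have uc : uniq c.
  rewrite -(map_inj_uniq (can_inj block_wordK)); apply: uniq_flatten_nil uf _.
  by rewrite nil_chain_word.
have cov : all [in f] (iota 1 m) by apply/allP => k; rewrite (perm_mem pf).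
rewrite uc cov c0 sumE // (perm_size pf) size_iota.
by move: cov; rewrite -flatten_chain_word_cover => /eqP->; rewrite cardsT card_ord eqxx.
Qed.

End Coding.

Lemma chain_word_inj m : injective (@chain_word m).
Proof. exact: inj_map (can_inj (@block_wordK m)). Qed.

Lemma perm_chain_words n :
  perm_eq [seq chain_word c | c : n.-bseq {set 'I_n} <- enum (WOC n)] (chain_words n).
Proof.
apply: uniq_perm; last 1 first.
- move=> ss; apply/mapP/idP => [[c]|ssn].
    by rewrite mem_enum inE -/(is_chain c) is_chainE => ? ->.
  have [pf st nz] := and3P (etrans (esym (mem_chain_words n ss)) ssn).
  (* Nonempty blocks number at most [n], as the bounded type [n.-bseq] requires. *)
  have sz : size ss <= n.
    rewrite -[n in _ <= n](size_iota 1) -(perm_size pf).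
    elim: ss nz {st pf ssn} => //= b ss IH; rewrite inE negb_or => /andP[nb /IH].
    by rewrite size_cat; case: b nb => //= _ b _; lia.
  pose c := [seq word_block n b | b <- ss].
  have cE : chain_word c = ss.
    rewrite /chain_word -map_comp -[RHS]map_id; apply/eq_in_map => b bs /=.
    rewrite word_blockK ?(allP st) // => k kb.
    by rewrite -(perm_mem pf); apply/flattenP; exists b.
  have sc : size c <= n by rewrite size_map.
  exists (Bseq sc); last by rewrite -cE.
  by rewrite mem_enum inE -/(is_chain c) is_chainE cE.
- by rewrite map_inj_uniq ?enum_uniq // => c d /chain_word_inj/val_inj.
- exact: uniq_chain_words.
Qed.

Lemma card_WOC n (P : pred (seq nat)) :
  #|[set c in WOC n | P (flatten (chain_word c))]| =
  \sum_(t <- permutations (iota 1 n) | P t) 2 ^ asc t.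
Proof.
transitivity (\sum_(ss <- chain_words n | P (flatten ss)) 1).
  rewrite -(perm_big _ (perm_chain_words n)) big_map /= big_enum_cond /= -sum1_card.
  by apply: eq_bigl => c; rewrite !inE.
rewrite big_mkcond big_allpairs_dep [RHS]big_mkcond; apply: eq_bigr => t _.
rewrite big_seq (eq_bigr (fun=> nat_of_bool (P t))) => [|ss].
  rewrite -big_seq big_const_seq count_predT iter_addn_0 size_splits.
  by case: (P t); rewrite ?mul1n ?mul0n.
by rewrite mem_splits => /and3P[/eqP-> _ _]; case: (P t).
Qed.

(** * Stopping condition and restriction read on words *)

(** Letters of one block are tied in the chain, but increasing order puts the smaller one first. For
    [x < y] a weak inequality of blocks is therefore a strict inequality of positions. *)
Lemma find_le_index (ss : seq (seq nat)) x y :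
  uniq (flatten ss) -> all (sorted ltn) ss -> x < y ->
  x \in flatten ss -> y \in flatten ss ->
  (find [pred b | x \in b] ss <= find [pred b | y \in b] ss) =
  (index x (flatten ss) < index y (flatten ss)).
Proof.
move=> + + xy; elim: ss => //= b ss IH; rewrite cat_uniq !mem_cat !index_cat.
move=> /and3P[_ bss us] /andP[sb ss_sorted].
have bss' z : z \in b -> z \in flatten ss = false.
  by move=> zb; apply: contraNF bss => zs; apply/hasP; exists z.
case xb: (x \in b); case yb: (y \in b) => //= xss yss.
- rewrite ltnNge; apply/esym/negP => yx; suff : y <= x by lia.
  have [/(index_inj 0 yb xb) ->//|ne] := eqVneq (index y b) (index x b).
  by apply: ltnW; apply: (sorted_ltn_index ltn_trans sb) => //; rewrite ltn_neqAle ne.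
- by rewrite ltn_addr // index_mem.
- have := index_mem y b; rewrite yb => /idP h; apply/esym/negbTE; rewrite -leqNgt.
  by rewrite ltnW // ltn_addr.
- by rewrite ltn_add2l ltnS IH.
Qed.

Lemma mem_flatten_chain_word m (c : seq {set 'I_m}) (i : 'I_m) :
  is_chain c -> i.+1 \in flatten (chain_word c).
Proof.
rewrite is_chainE mem_chain_words => /and3P[pf _ _].
by rewrite (perm_mem pf) mem_iota /= add1n ltnS.
Qed.

Lemma chain_leE m (c : seq {set 'I_m}) (i j : 'I_m) : is_chain c -> i < j ->
  chain_le c i j =
  (index i.+1 (flatten (chain_word c)) < index j.+1 (flatten (chain_word c))).
Proof.
move=> cc ij; have: chain_word c \in chain_words m by rewrite -is_chainE.
rewrite mem_chain_words => /and3P[pf sf _].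
rewrite -find_le_index ?mem_flatten_chain_word ?(perm_uniq pf) ?iota_uniq //.
by rewrite !find_map; congr (_ <= _); apply: eq_find => B /=; rewrite mem_block_word.
Qed.

(** Indices of the variables are the letters and the chain order is the order of positions, so
    positions and values exchange roles; 123 is its own inverse. *)
Lemma stop_le_leE m (c : seq {set 'I_m}) : is_chain c ->
  stop_le_le c = inc3 (flatten (chain_word c)).
Proof.
move=> cc; rewrite -contains123E; set t := flatten _.
have mt (i : 'I_m) : i.+1 \in t by apply: mem_flatten_chain_word.
have ut : uniq t /\ forall p, p < size t -> exists i : 'I_m, nth 0 t p = i.+1.
  move: cc; rewrite is_chainE mem_chain_words => /and3P[pf _ _].
  split=> [|p pt]; first by rewrite (perm_uniq pf) iota_uniq.
  have := mem_nth 0 pt; rewrite (perm_mem pf) mem_iota.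
  by case: nth => // k; rewrite add1n /= ltnS => km; exists (Ordinal km).
case: ut => ut tv; apply/existsP/existsP => -[].
  move=> i1 /existsP[i2 /existsP[i3 /and4P[i12 i23]]]; rewrite !chain_leE // => x12 x23.
  have it (i : 'I_m) : index i.+1 t < size t by rewrite index_mem.
  exists (Ordinal (it i1)); apply/existsP; exists (Ordinal (it i2)).
  by apply/existsP; exists (Ordinal (it i3)); rewrite /= !nth_index //; apply/and4P.
case=> p1 /= h1 /existsP[[p2 h2] /existsP[[p3 h3] /= /and4P[p12 p23]]].
have [i1 e1] := tv _ h1; have [i2 e2] := tv _ h2; have [i3 e3] := tv _ h3.
rewrite e1 e2 e3 => i12 i23; exists i1; apply/existsP; exists i2; apply/existsP; exists i3.
have {}i12 : i1 < i2 := i12; have {}i23 : i2 < i3 := i23.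
by rewrite i12 i23 !chain_leE // -/t -e1 -e2 -e3 !index_uniq // p12 p23.
Qed.

Lemma restrict_word m (c : seq {set 'I_m.+1}) :
  flatten (chain_word (restrict c)) = [seq k <- flatten (chain_word c) | k != m.+1].
Proof.
have blockE (A : {set 'I_m.+1}) :
    block_word [set i : 'I_m | widen_ord (leqnSn m) i \in A] =
    [seq k <- block_word A | k != m.+1].
  apply: (irr_sorted_eq ltn_trans ltnn); rewrite ?(sorted_filter ltn_trans) ?block_word_sorted //.
  move=> k; rewrite mem_filter; apply/idP/andP => [/mapP[i + ->]|[km /mapP[i]]].
    rewrite mem_enum inE -mem_block_word /= => ->; split=> //.
    by have := ltn_ord i; rewrite eqSS neq_ltn => ->.
  rewrite mem_enum => iA kE; have im : i < m.
    by have := ltn_ord i; move: km; rewrite kE eqSS ltnS leq_eqVlt => /negbTE->.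
  rewrite kE (mem_block_word _ (Ordinal im)) inE.
  by rewrite (_ : widen_ord _ _ = i) //; apply/val_inj.
elim: c => [|A c IH] //; pose B := [set i : 'I_m | widen_ord (leqnSn m) i \in A].
rewrite -[restrict (A :: c)]/(if B != set0 then B :: restrict c else restrict c).
rewrite [flatten (chain_word (A :: c))]/= filter_cat -IH -blockE -/B.
by have [->|_] := eqVneq B set0; rewrite //= /block_word enum_set0.
Qed.

Lemma filter_iota_last m : [seq k <- iota 1 m.+1 | k != m.+1] = iota 1 m.
Proof.
have -> : iota 1 m.+1 = iota 1 m ++ [:: m.+1] by rewrite -[m.+1]addn1 iotaD addn1.
rewrite filter_cat /= eqxx cats0.
by apply/all_filterP/allP => k; rewrite mem_iota; lia.
Qed.

Lemma is_chain_restrict m (c : seq {set 'I_m.+1}) : is_chain c -> is_chain (restrict c).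
Proof.
rewrite !is_chainE !mem_chain_words !chain_word_sorted !nil_chain_word /=.
move=> /andP[pf _]; rewrite restrict_word -filter_iota_last perm_filter //=.
by rewrite mem_filter eqxx.
Qed.

(** Ancestors arise by deleting letters, and deletion never creates 123. Once the parent avoids the
    pattern, all earlier ancestors do. *)
Lemma in_restricted_treeE m (c : seq {set 'I_m.+1}) : is_chain c ->
  in_restricted_tree stop_le_le c =
  ~~ inc3 [seq k <- flatten (chain_word c) | k != m.+1].
Proof.
elim: m c => [|m IH] c cc.
  rewrite /= -restrict_word; set t := flatten _.
  suff : size t = 0 by case: t.
  have := is_chain_restrict cc; rewrite is_chainE mem_chain_words => /and3P[pf _ _].
  by rewrite (perm_size pf).
have rc := is_chain_restrict cc.
transitivity (in_restricted_tree stop_le_le (restrict c) && ~~ stop_le_le (restrict c)) => //.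
rewrite IH // -(restrict_word c) stop_le_leE //.
case i3: (inc3 (flatten _)); first by rewrite andbF.
by rewrite (contraFF (@inc3_filter _ _) i3).
Qed.

Definition weight (P : pred (seq nat)) n := \sum_(t <- permutations (iota 1 n) | P t) 2 ^ asc t.

Definition avoiding t := ~~ inc3 t.
(* A word on 1, ..., n that contains 123, but no longer so without n: the
   chains it represents are the stopped leaves of level n. *)
Definition newly n t := inc3 t && ~~ inc3 [seq k <- t | k != n].

(** Both kinds together are all nodes of level [n], because an avoiding word stays avoiding without
    its largest letter. *)
Lemma weight_newlyD n : weight avoiding n + weight (newly n) n =
  weight (fun t => ~~ inc3 [seq k <- t | k != n]) n.
Proof.
rewrite /weight [in LHS]big_mkcond [X in _ + X]big_mkcond -big_split [RHS]big_mkcond /=.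
apply: eq_bigr => t _; rewrite /avoiding /newly.
case i3: (inc3 t) => //=; rewrite addn0.
by rewrite (contraFF (@inc3_filter _ _) i3).
Qed.

Lemma num_chains_weight n : 0 < n ->
  w n = weight avoiding n + \sum_(1 <= j < n.+1) weight (newly j) j.
Proof.
case: n => // n _; rewrite /w /num_chains big_nat_recr // [in RHS]big_nat_recr // addnCA.
have cardE m (P : pred (m.-bseq {set 'I_m})) (Q : pred (seq nat)) :
    (forall c, c \in WOC m -> P c = Q (flatten (chain_word c))) ->
    #|[set c in WOC m | P c]| = weight Q m.
  move=> PQ; rewrite /weight -card_WOC; apply: eq_card => c.
  by rewrite inE [RHS]inE; case cm: (c \in WOC m) => //=; apply: PQ.
(* Below the last level only stopped nodes are leaves; on the last level every node is one. *)
congr (_ + _).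
  apply: eq_big_nat => -[|m] /andP[// _ mn]; apply: cardE => c; rewrite inE -/(is_chain c) => cc.
  by rewrite in_restricted_treeE // stop_le_leE // (ltn_eqF mn) /newly andbC.
rewrite weight_newlyD; apply: cardE => c; rewrite inE -/(is_chain c) => cc.
by rewrite in_restricted_treeE // eqxx andbT.
Qed.

(** * Counting by descents *)

Lemma asc_ltn_size x u : asc (x :: u) <= size u.
Proof.
elim: u x => //= y u IH x; have := IH y => /=; have := leq_b1 (x < y); lia.
Qed.

Lemma asc_sorted u : asc u = (size u).-1 -> sorted ltn u.
Proof.
case: u => // x u; elim: u x => //= y u IH x.
have := asc_ltn_size y u => /=; have [xy|_] := ltnP x y; last by lia.
by rewrite add1n => _ [h]; apply: IH.
Qed.

Lemma uniq_perms_iota n t : t \in permutations (iota 1 n) -> uniq t /\ size t = n.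
Proof.
by rewrite mem_permutations => p; rewrite (perm_uniq p) (perm_size p) iota_uniq size_iota.
Qed.

Lemma weight_descents n P : 0 < n ->
  weight P n = \sum_(0 <= d < n) 2 ^ (n - 1 - d) *
                 \sum_(t <- permutations (iota 1 n) | P t && (descents t == d)) 1.
Proof.
case: n => // n _; rewrite big_mkord.
have desc t : t \in permutations (iota 1 n.+1) -> descents t + asc t = n.
  by move=> /uniq_perms_iota[ut st]; rewrite descents_asc // st.
rewrite /weight (partition_big (fun t => inord (descents t) : 'I_n.+1) predT) //=.
apply: eq_bigr => d _; rewrite big_distrr /= big_seq_cond [RHS]big_seq_cond.
apply: eq_big => [t|t /and3P[tn _ /eqP <-]].
  case tn: (t \in _) => //=; congr (_ && _); rewrite -val_eqE /= inordK //.
  by have := desc _ tn; lia.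
have dn := desc _ tn; rewrite muln1 inordK; last by lia.
by congr (_ ^ _); lia.
Qed.

Lemma e_sum n d : e n d =
  \sum_(t <- permutations (iota 1 n) | avoiding t && (descents t == d)) 1.
Proof.
rewrite /e -(card_oneline n (fun t => avoiding t && (descents t == d))).
by apply: eq_card => s; rewrite !inE contains123E.
Qed.

(** This explains the range of [d] in [G]. The only word without descents is the identity, which for
    [j > 3] contains 123 even without [j]; the two ascents of a 123 give the upper bound. *)
Lemma newly_descents j t : t \in permutations (iota 1 j) -> newly j t ->
  (3 < j -> 0 < descents t) /\ descents t <= j - 3.
Proof.
move=> tj /andP[/inc3_asc a2 nf]; have [ut st] := uniq_perms_iota tj.
have := descents_asc ut; rewrite st => dj; split; last by lia.
move=> j3; rewrite lt0n; apply: contraNneq nf => d0.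
have -> : t = iota 1 j.
  apply: (sorted_eq leq_trans anti_leq); rewrite ?iota_sorted -?mem_permutations //.
  apply: (sub_sorted ltnW); by apply: asc_sorted; rewrite st -dj d0.
have [k ->] : exists k, j = k.+4 by exists (j - 4); lia.
by rewrite filter_iota_last.
Qed.

Lemma g_sum j d : 2 < j -> d <= j - 3 -> g j d =
  \sum_(t <- permutations (iota 1 j) | newly j t && (descents t == d)) 1.
Proof.
move=> j2 dj; rewrite /g /G; have [j3|j3] := ltnP 3 j; last first.
  have jE : j = 3 by lia.
  have dE : d = 0 by lia.
  rewrite {j dj j2 j3}jE {d}dE eqxx cards1 sum1_count.
  (* The cardinal in [descents] does not compute; with two ascents in place of no descent, the six
     permutations are checked by evaluation. *)
  rewrite (@eq_in_count _ _ (fun t => newly 3 t && (asc t == 2))) // => t.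
  move=> /uniq_perms_iota[ut st]; have := descents_asc ut; rewrite st => h.
  by congr (_ && _); apply/eqP/eqP; lia.
rewrite dj andbT /=; case: d dj => [|d] dj /=.
  rewrite (gtn_eqF j3) cards0 big_seq_cond big1 // => t /and3P[tj tn /eqP d0].
  by have [/(_ j3)] := newly_descents tj tn; rewrite d0.
rewrite -(card_oneline j (fun t => newly j t && (descents t == d.+1))).
apply: eq_card => s; rewrite !inE /newly !contains123E.
have [us _] := uniq_perms_iota (oneline_perms s).
by rewrite rem_filter //; do 2!case: inc3; rewrite ?andbF ?andbT.
Qed.

Lemma w_descents n : 0 < n ->
  w n = \sum_(0 <= d < n) 2 ^ (n - 1 - d) * e n d +
        \sum_(3 <= j < n.+1) \sum_(0 <= d < (j - 3).+1) 2 ^ (j - 1 - d) * g j d.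
Proof.
move=> n0; rewrite num_chains_weight // weight_descents //; congr (_ + _).
  by apply: eq_bigr => d _; rewrite e_sum.
have w0 j : 0 < j -> j < 3 -> weight (newly j) j = 0.
  move=> j0 j3; rewrite /weight big_seq_cond big1 // => t /andP[tj /andP[/inc3_asc]].
  have [ut st] := uniq_perms_iota tj; have := descents_asc ut; lia.
have w3 j : 2 < j -> weight (newly j) j = \sum_(0 <= d < (j - 3).+1) 2 ^ (j - 1 - d) * g j d.
  move=> j2; rewrite weight_descents; last by lia.
  (* The classes with more than [j - 3] descents are empty. *)
  rewrite (big_cat_nat (n := (j - 3).+1)) //=; last by lia.
  rewrite [X in _ + X]big_nat_cond [X in _ + X]big1 ?addn0 => [|d /andP[/andP[jd _] _]].
    apply: eq_big_nat => d /andP[_ dj]; congr (_ * _).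
    by rewrite [RHS]g_sum.
  rewrite big_seq_cond big1 ?muln0 // => t /and3P[tj tn /eqP dE].
  by have [_] := newly_descents tj tn; rewrite dE leqNgt jd.
case: (ltnP n 2) => [n2|n2].
  have -> : n = 1 by lia.
  by rewrite big_nat1 w0 // big_geq.
rewrite (big_cat_nat (n := 3)) //= big_nat_cond big1 => [|j /andP[/andP[j0 j3] _]]; last exact: w0.
by apply: eq_big_nat => j /andP[j2 _]; apply: w3.
Qed.

(** * Insertion of the largest value *)

Fixpoint inserts (N : nat) (t : seq nat) : seq (seq nat) :=
  (N :: t) :: (if t is x :: t' then [seq x :: v | v <- inserts N t'] else [::]).

Lemma size_inserts N t : size (inserts N t) = (size t).+1.
Proof. by elim: t => //= x t IH; rewrite size_map IH. Qed.

Lemma perm_inserts N t v : v \in inserts N t -> perm_eq v (N :: t).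
Proof.
elim: t v => [|x t IH] v /=; first by rewrite inE => /eqP->.
rewrite inE => /predU1P[->//|/mapP[u /IH ut ->]].
by rewrite -[N :: x :: t]/([:: N] ++ [:: x] ++ t) perm_sym perm_catCA /= perm_cons perm_sym.
Qed.

Lemma filter_inserts N t v : N \notin t -> v \in inserts N t -> [seq k <- v | k != N] = t.
Proof.
have filt s : N \notin s -> [seq k <- s | k != N] = s.
  by move=> Ns; apply/all_filterP/allP => k ks; apply: contraNneq Ns => <-.
elim: t v => [|x t IH] v /=; first by move=> _; rewrite inE => /eqP-> /=; rewrite eqxx.
rewrite inE => /norP[Nx Nt]; rewrite inE => /predU1P[->|/mapP[u uN ->]] /=.
  by rewrite eqxx eq_sym Nx filt.
by rewrite eq_sym Nx IH.
Qed.

Lemma uniq_inserts N t : N \notin t -> uniq (inserts N t).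
Proof.
elim: t => //= x t IH; rewrite inE => /norP[Nx /IH ut].
rewrite map_inj_uniq ?ut ?andbT => [|u v [->]//].
by apply/mapP => -[u _ [/eqP]]; rewrite (negPf Nx).
Qed.

(** Deleting [n.+1] inverts the insertion, so there are no repetitions, and the lengths agree by
    [(n + 1)! = (n + 1) n!]. *)
Lemma perm_permutations_inserts n :
  perm_eq (permutations (iota 1 n.+1))
    [seq v | t <- permutations (iota 1 n), v <- inserts n.+1 t].
Proof.
have nt t : t \in permutations (iota 1 n) -> n.+1 \notin t.
  by rewrite mem_permutations => /perm_mem->; rewrite mem_iota; lia.
pose s := [seq v | t <- permutations (iota 1 n), v <- inserts n.+1 t].
have us : uniq s.
  apply: allpairs_uniq_dep => [|t /nt/uniq_inserts//|]; first exact: permutations_uniq.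
  move=> _ _ /allpairsPdep[t [v [/nt tn vt ->]]] /allpairsPdep[t' [v' [/nt tn' vt' ->]]] /= vv'.
  have -> : t = t' by rewrite -(filter_inserts tn vt) -(filter_inserts tn' vt') vv'.
  by rewrite vv'.
rewrite perm_sym -/s; apply: uniq_perm => //; first exact: permutations_uniq.
apply: (uniq_min_size us _ _).2 => [v /allpairsPdep[t [v' [tp /perm_inserts vp ->]]]|].
  move: tp; rewrite !mem_permutations => tp; apply: perm_trans vp _.
  have -> : iota 1 n.+1 = iota 1 n ++ [:: n.+1] by rewrite -[n.+1]addn1 iotaD addn1.
  rewrite perm_sym perm_catC /= perm_cons perm_sym.
  exact: tp.
rewrite size_allpairs_dep size_permutations ?iota_uniq // size_iota.
suff /eq_in_map -> : {in permutations (iota 1 n), size \o inserts n.+1 =1 fun=> n.+1}.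
  rewrite sumnE big_map big_const_seq count_predT iter_addn_0 size_permutations ?iota_uniq //.
  by rewrite size_iota factS.
move=> t; rewrite mem_permutations /= size_inserts => /perm_size->; by rewrite size_iota.
Qed.

(** Insertion at an ascent preserves the number [a] of ascents; at a descent or at the end it adds
    one. With [l] places after a letter this gives [2^a (a + 2 (l - a))]. The term with [a] is kept
    on the left to avoid truncated subtraction. *)
Lemma sum_inserts_cons N x t : all (ltn^~ N) (x :: t) ->
  \sum_(v <- inserts N t) 2 ^ asc (x :: v) + 2 ^ asc (x :: t) * asc (x :: t) =
  2 ^ asc (x :: t) * (2 * (size t).+1).
Proof.
elim: t x => [|y t IH] x; first by rewrite /= big_seq1 /= => /andP[-> _].
move=> /andP[xN yt]; have /andP[yN _] := yt.
have {}xN : x < N := xN; have {}yN : y < N := yN.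
rewrite [inserts _ _]/= big_cons big_map.
have -> : \sum_(v <- inserts N t) 2 ^ asc [:: x, y & v] =
    2 ^ (x < y) * \sum_(v <- inserts N t) 2 ^ asc (y :: v).
  rewrite big_distrr; apply: eq_bigr => v _; exact: expnD.
have := IH _ yt; rewrite -[asc [:: x, y & t]]/((x < y) + asc (y :: t)).
rewrite -[asc [:: x, N, y & t]]/((x < N) + ((N < y) + asc (y :: t))).
rewrite xN ltnNge (ltnW yN) /= add0n; set a := (y < _) + _; set S := bigop.body _ _ _.
by case: (x < y); rewrite !expnD ?expn1 ?expn0; nia.
Qed.

Lemma sum_inserts N t : t != [::] -> all (ltn^~ N) t ->
  \sum_(v <- inserts N t) 2 ^ asc v + 2 ^ asc t * asc t = 2 ^ asc t * (2 * size t).+1.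
Proof.
case: t => // x t _ xt; have /andP[xN _] := xt.
have {}xN : x < N := xN; have := sum_inserts_cons xt; rewrite [inserts _ _]/= big_cons big_map.
rewrite -[asc [:: N, x & t]]/((N < x) + asc (x :: t)) ltnNge (ltnW xN) add0n.
set S := \sum_(v <- inserts N t) _; set a := asc (x :: t); set b := 2 ^ a.
by move=> SE; rewrite mulnS -addnA SE.
Qed.

(** Passing to level [n + 1] replaces the avoiding leaves of level [n] by their children. A word
    with [a] ascents loses [2^a] leaves and gains [2^a (2n + 1 - a)]. *)
Lemma w_step n : 0 < n ->
  w n.+1 + \sum_(t <- permutations (iota 1 n) | avoiding t) 2 ^ asc t * asc t =
  w n + \sum_(t <- permutations (iota 1 n) | avoiding t) 2 ^ asc t * (2 * n).
Proof.
move=> n0; rewrite !num_chains_weight // big_nat_recr // [in LHS]addnCA weight_newlyD.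
rewrite -addnA [weight avoiding n + _]addnC -[RHS]addnA; congr (_ + _).
have -> : weight (fun t => ~~ inc3 [seq k <- t | k != n.+1]) n.+1 =
    \sum_(t <- permutations (iota 1 n) | avoiding t) \sum_(v <- inserts n.+1 t) 2 ^ asc v.
  rewrite /weight (perm_big _ (perm_permutations_inserts n)) /= big_mkcond.
  rewrite big_allpairs_dep [RHS]big_mkcond big_seq [RHS]big_seq; apply: eq_bigr => t.
  rewrite mem_permutations => /perm_mem tn.
  have nt : n.+1 \notin t by rewrite tn mem_iota; lia.
  rewrite -big_mkcond big_seq_cond; case: ifP => at_; last first.
    by rewrite big1 // => v /andP[/(filter_inserts nt)-> h]; rewrite /avoiding h in at_.
  rewrite [RHS]big_seq; apply: eq_bigl => v; case vt: (v \in _) => //=.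
  by rewrite (filter_inserts nt vt).
rewrite /weight -!big_split /= big_seq_cond [RHS]big_seq_cond.
apply: eq_bigr => t /andP[+ _]; rewrite mem_permutations => tn.
rewrite sum_inserts.
- by rewrite (perm_size tn) size_iota mulnS addnC.
- by apply: contraTneq tn => ->; case: (n) n0.
- by apply/allP => k; rewrite (perm_mem tn) mem_iota => /andP[].
Qed.

(** * Reading avoiding words from left to right *)

(* Number of k-step paths from r to 0 in the nonnegative integers with steps
   r -> r' for all r' >= r - 1; the k-th Catalan number for r = 0. *)
Fixpoint paths (k r : nat) : nat :=
  if k is k'.+1 then sumn [seq paths k' i | i <- index_iota r.-1 k] else r == 0.

Lemma pathsS k r : paths k.+1 r = \sum_(r.-1 <= i < k.+1) paths k i.
Proof. by rewrite /= sumnE big_map. Qed.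

Lemma paths_gt k r : k < r -> paths k r = 0.
Proof.
case: k => [|k]; first by case: r.
by move=> kr; rewrite pathsS big_geq //; lia.
Qed.

(** A step descends by at most one, so heights above [k] contribute nothing and any upper bound
    beyond [k] gives the same sum. *)
Lemma paths_sum k r n : k < n -> \sum_(r.-1 <= i < n) paths k i = paths k.+1 r.
Proof.
move=> kn; rewrite pathsS; have [rk|kr] := leqP r.-1 k.+1.
  rewrite (big_cat_nat rk) //= -[RHS]addn0; congr (_ + _).
  by rewrite big_nat_cond big1 // => i /andP[/andP[ki _] _]; rewrite paths_gt.
rewrite [RHS]big_geq 1?ltnW // big_nat_cond big1 // => i /andP[/andP[ki _] _].
by rewrite paths_gt // (leq_trans _ ki) // ltnW.
Qed.

Lemma inc2_has x u : inc2 x u -> has (ltn x) u.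
Proof. by elim: u => //= y u IH /orP[/andP[->//]|/IH->]; apply: orbT. Qed.

(** The number of larger elements is a rank: it is strictly decreasing in [x], hence injective, and
    takes every value below [size V]. *)
Lemma big_count_ltn (R : nmodType) (V : seq nat) (F : nat -> R) : uniq V ->
  (\sum_(x <- V) F (count (ltn x) V) = \sum_(0 <= i < size V) F i)%R.
Proof.
move=> uV; rewrite -(big_map (fun x => count (ltn x) V) predT F); apply: perm_big.
have cnt x y : y \in V -> x < y -> count (ltn y) V < count (ltn x) V.
  move=> /perm_to_rem/seq.permP cV xy; rewrite !cV /= ltnn xy add0n add1n ltnS.
  by apply: sub_count => z /=; apply: ltn_trans.
have um : uniq [seq count (ltn x) V | x <- V].
  rewrite map_inj_in_uniq // => x y xV yV cxy.
  by case: (ltngtP x y) => // [/(cnt _ _ yV)|/(cnt _ _ xV)]; rewrite cxy ltnn.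
apply: uniq_perm; rewrite ?iota_uniq //.
apply: (uniq_min_size um _ _).2; last by rewrite size_map size_iota subn0.
move=> _ /mapP[x xV ->]; rewrite mem_index_iota /=.
have p := perm_to_rem xV; rewrite (seq.permP p) (perm_size p) /= ltnn add0n ltnS.
exact: count_size.
Qed.

Local Open Scope ring_scope.

Section AscentPolynomial.
Variables (R : comNzRingType) (q : R).

(* Avoiding completions using n more values, r of which lie above the current
   minimum: k blocks, n - k of them of size two, each of the latter marked by q. *)
Definition phi (r n : nat) : R :=
  \sum_(0 <= k < n.+1) (paths k r * 'C(k, n - k))%:R * q ^+ (n - k).

(** Pascal's rule for ['C(k.+1, n - k)] separates a first block that is a singleton from one that is
    a pair, the latter costing [q] and one more value. *)
Lemma phi_rec r n : phi r n.+1 =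
  \sum_(r.-1 <= i < n.+1) phi i n + q * \sum_(r.-1 <= i < n) phi i n.-1.
Proof.
have sumE (N M : nat) (a : nat -> nat) (b : nat -> R) : (M <= N)%N ->
    \sum_(r.-1 <= i < N) \sum_(0 <= k < M) (paths k i * a k)%:R * b k =
    \sum_(0 <= k < M) (paths k.+1 r * a k)%:R * b k.
  move=> MN; rewrite exchange_big_nat; apply: eq_big_nat => k /andP[_ kM].
  by rewrite -mulr_suml -natr_sum -big_distrl paths_sum // (leq_trans kM).
rewrite {1}/phi big_nat_recl // bin0n muln0 mul0r add0r.
rewrite (sumE n.+1 n.+1 (fun k => 'C(k, n - k)) (fun k => q ^+ (n - k))) //.
case: n => [|n].
  by rewrite [X in q * X]big_geq // mulr0 addr0 !big_nat1 subSS !bin0.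
rewrite (sumE n.+1 n.+1 (fun k => 'C(k, n - k)) (fun k => q ^+ (n - k))) //.
(* The term without pairs occurs only in the singleton sum and is split off before Pascal's rule. *)
rewrite !(@big_nat_recr _ _ _ n.+1) //= !subSS !subnn !bin0 addrAC; congr (_ + _).
rewrite big_distrr -big_split /=; apply: eq_big_nat => k /andP[_ kn].
by rewrite subSS subSn // binS mulnDr natrD exprS; ring.
Qed.

(* The possible continuations of a prefix with minimum m. *)
Definition avoids_above (m : nat) (u : seq nat) := ~~ inc2 m u && ~~ inc3 u.

(** A 123 that starts at the old minimum also gives one that starts at the smaller [x]. *)
Lemma avoids_above_cons_lt m x u : (x < m)%N ->
  avoids_above m (x :: u) = avoids_above x u.
Proof.
move=> xm; rewrite /avoids_above /= ltnNge (ltnW xm) /= negb_or andbA -negb_or.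
by case mu: (inc2 m u) => //=; rewrite (inc2_leq (ltnW xm) mu).
Qed.

Lemma avoids_above_cons_max m x u : (m < x)%N -> ~~ has (ltn x) u ->
  avoids_above m (x :: u) = avoids_above m u.
Proof.
move=> mx xu; rewrite /avoids_above /= mx (negPf xu) /=.
by rewrite (contraNF (@inc2_has x u) xu).
Qed.

Lemma avoids_above_cons_has m x u : (m < x)%N -> has (ltn x) u ->
  avoids_above m (x :: u) = false.
Proof. by move=> mx xu; rewrite /avoids_above /= mx xu. Qed.

Lemma asc_cons_max x u : ~~ has (ltn x) u -> asc (x :: u) = asc u.
Proof.
case: u => //= y u; rewrite negb_or => /andP[xy _].
by rewrite (_ : (x < y)%N = false) ?add0n //; apply/negbTE.
Qed.

Lemma sum_avoids_above n V m : uniq V -> m \notin V -> size V = n ->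
  let r := count (ltn m) V in
  \sum_(u <- permutations V | avoids_above m u) (1 + q) ^+ asc u = phi r n /\
  \sum_(u <- permutations V | avoids_above m u) (1 + q) ^+ asc (m :: u) =
    phi r n + (if (0 < r)%N then q * phi r.-1 n.-1 else 0).
Proof.
elim: n V m => [|n IH] V m uV mV sV r.
  rewrite {}/r; case: V sV {uV mV} => //= _.
  by rewrite !big_cons !big_nil /= /phi big_nat1 !addr0 !mulr1.
have permE (F : seq nat -> R) : \sum_(u <- permutations V) F u =
    \sum_(x <- V) \sum_(u <- permutations (rem x V)) F (x :: u).
  rewrite (perm_big _ (permutationsE _)) ?sV //= big_allpairs_dep undup_id //.
pose c x := count (ltn x) V.
have rc x : x \in V -> (r <= c x)%N = (x < m)%N.
  move=> xV; case: (ltngtP x m) => [xm|mx|xm]; last by rewrite -xm xV in mV.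
    by apply: sub_count => z /=; apply: ltn_trans.
  apply/negbTE; rewrite -ltnNge /r /c !(seq.permP (perm_to_rem xV)) /= ltnn mx ltnS.
  by apply: sub_count => z /=; apply: ltn_trans.
have has_rem x u : x \in V -> u \in permutations (rem x V) -> has (ltn x) u = (0 < c x)%N.
  move=> xV; rewrite mem_permutations => /seq.permP uE.
  by rewrite has_count uE /c (seq.permP (perm_to_rem xV)) /= ltnn.
pose tau i : R := if (r <= i)%N then phi i n + (if (0 < i)%N then q * phi i.-1 n.-1 else 0)
                  else if i == 0%N then phi r.-1 n else 0.
have remP x : x \in V -> [/\ uniq (rem x V), x \notin rem x V, size (rem x V) = n
    & forall y, ~~ (y < x)%N -> count (ltn y) (rem x V) = c y].
  move=> xV; split; rewrite ?rem_uniq ?mem_rem_uniqF ?size_rem ?sV //.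
  by move=> y yx; rewrite /c [in RHS](seq.permP (perm_to_rem xV)) /= (negPf yx).
have sum_lt x : x \in V -> (x < m)%N ->
    \sum_(u <- permutations (rem x V) | avoids_above m (x :: u)) (1 + q) ^+ asc (x :: u) = tau (c x).
  move=> xV xm; have [ur xr sr cr] := remP x xV; rewrite /tau rc // xm.
  rewrite (eq_bigl (avoids_above x)) => [|u]; last exact: avoids_above_cons_lt.
  by have [_ ->] := IH _ _ ur xr sr; rewrite cr ?ltnn.
have sum_gt x : x \in V -> (m < x)%N ->
    \sum_(u <- permutations (rem x V) | avoids_above m (x :: u)) (1 + q) ^+ asc (x :: u) = tau (c x).
  move=> xV mx; have [ur xr sr cr] := remP x xV.
  have mr : m \notin rem x V by apply: contra mV => /mem_rem.
  have crm : count (ltn m) (rem x V) = r.-1.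
    by rewrite /r (seq.permP (perm_to_rem xV)) /= mx.
  rewrite /tau rc // ltnNge (ltnW mx) /= big_seq_cond; case: eqP => [c0|/eqP cx]; last first.
    rewrite big1 // => u /andP[up]; rewrite avoids_above_cons_has //.
    by rewrite (has_rem _ _ xV up) lt0n.
  rewrite -crm; have [<- _] := IH _ _ ur mr sr.
  rewrite [RHS]big_seq_cond; apply: eq_big => [u|u /andP[up _]].
    case up: (u \in _) => //=; apply: avoids_above_cons_max => //.
    by rewrite (has_rem _ _ xV up) c0.
  congr (_ ^+ _); apply: asc_cons_max; by rewrite (has_rem _ _ xV up) c0.
have sum_cons x : x \in V ->
    \sum_(u <- permutations (rem x V) | avoids_above m (x :: u)) (1 + q) ^+ asc (x :: u) = tau (c x).
  move=> xV; case: (ltngtP x m) => [xm|mx|xm]; [exact: sum_lt | exact: sum_gt | ].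
  by rewrite -xm xV in mV.
have sumV (F : nat -> R) : \sum_(x <- V) F (c x) = \sum_(0 <= i < n.+1) F i.
  by rewrite big_count_ltn // sV.
have NN : \sum_(u <- permutations V | avoids_above m u) (1 + q) ^+ asc u = phi r n.+1.
  rewrite big_mkcond permE; under eq_bigr => x _ do rewrite -big_mkcond.
  rewrite big_seq (eq_bigr (tau \o c)) // -big_seq sumV phi_rec.
  have : (r <= n.+1)%N by rewrite -sV count_size.
  rewrite /tau; move: (r) => [|r'] rn.
    rewrite big_split /=; congr (_ + _); rewrite big_nat_recl //= add0r big_distrr //=.
  rewrite (big_cat_nat _ rn) //= big_nat_recl // big_nat_cond big1 => [|i]; last first.
    by rewrite andbT /= => ir; rewrite ltnS leqNgt ir.
  rewrite /= addr0 [in RHS]big_ltn // -addrA; congr (_ + _).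
  transitivity (\sum_(r'.+1 <= i < n.+1) phi i n + \sum_(r'.+1 <= i < n.+1) q * phi i.-1 n.-1).
    by rewrite -big_split; apply: eq_big_nat => -[|i] /andP[ri _] //; rewrite ri.
  by rewrite [X in _ + X]big_add1 big_distrr.
split=> //; rewrite -NN big_mkcond permE [X in _ = X + _]big_mkcond permE.
(* The junction is an ascent only if the first letter is the largest of [V] and exceeds [m]; the
   part [q] of its factor [1 + q] gives the extra term. *)
have -> : (if (0 < r)%N then q * phi r.-1 n.+1.-1 else 0) =
    \sum_(x <- V) (if (c x < r)%N && (c x == 0%N) then q * phi r.-1 n else 0).
  rewrite (sumV (fun i => if (i < r)%N && (i == 0%N) then _ else _)).
  by rewrite big_nat_recl // big1 ?addr0 ?andbT // => i _; rewrite andbF.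
rewrite -big_split [LHS]big_seq [RHS]big_seq; apply: eq_bigr => x xV.
rewrite -!big_mkcond sum_cons //; have := rc _ xV; case: (ltngtP x m) => [xm|mx|xm] rcx.
- rewrite [X in _ = _ + X](_ : _ = 0) ?addr0 -?sum_cons //; last by rewrite ltnNge rcx.
  apply: eq_bigr => u _.
  by rewrite -[asc (m :: _)]/((m < x)%N + asc (x :: u))%N ltnNge (ltnW xm).
- rewrite [(c x < r)%N]ltnNge rcx andTb.
  under eq_bigr => u _ do rewrite -[asc (m :: _)]/((m < x)%N + asc (x :: u))%N mx exprS.
  rewrite -big_distrr /= sum_cons // mulrDl mul1r; congr (_ + _).
  by rewrite /tau rcx; case: ifP; rewrite ?mulr0.
- by rewrite -xm xV in mV.
Qed.

(** A fictitious minimum [n.+1] exceeds every letter, so it imposes no constraint and has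
    [r = 0]. *)
Lemma sum_avoiding n :
  \sum_(t <- permutations (iota 1 n) | avoiding t) (1 + q) ^+ asc t = phi 0 n.
Proof.
have [] := @sum_avoids_above n (iota 1 n) n.+1; rewrite ?iota_uniq ?size_iota //.
  by rewrite mem_iota; lia.
have -> : count (ltn n.+1) (iota 1 n) = 0%N.
  by apply/eqP; rewrite -leqn0 leqNgt -has_count; apply/hasPn => k; rewrite mem_iota /=; lia.
move=> <- _; rewrite big_seq_cond [RHS]big_seq_cond; apply: eq_bigl => t.
case tn: (t \in _) => //=; rewrite /avoids_above; case: (boolP (inc2 _ _)) => //.
move: tn; rewrite mem_permutations => /perm_mem tn /inc2_has/hasP[k].
by rewrite tn mem_iota /=; lia.
Qed.

End AscentPolynomial.

(** * Recurrence and first values of [w] *)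

Definition total_blocks (n : nat) : nat :=
  (\sum_(0 <= k < n.+1) k * (paths k 0 * 'C(k, n - k)))%N.

(** The ascent polynomial at [q = 1] sums [2^a], and twice its derivative there sums [2^a a]. Since
    [n - k] counts equalities, the difference [2n - 2(n - k)] leaves twice the number [k] of
    blocks. *)
Lemma w_rec n : (0 < n)%N -> w n.+1 = (w n + 2 * total_blocks n)%N.
Proof.
move=> n0; have := w_step n0; set A := (X in (_ + X)%N = _); set B := (X in _ = (_ + X)%N) => wS.
pose P k := (paths k 0 * 'C(k, n - k))%N.
have BE : B = (2 * n * \sum_(0 <= k < n.+1) P k)%N.
  have S1 := sum_avoiding (1 : int) n.
  rewrite [RHS]mulnC /B -big_distrl /=; congr (_ * _)%N.
  apply/eqP; rewrite -eqz_nat; apply/eqP; rewrite -!natz !natr_sum.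
  transitivity (\sum_(t <- permutations (iota 1 n) | avoiding t) (1 + 1 : int) ^+ asc t).
    by apply: eq_bigr => t _; rewrite natrX.
  by rewrite S1; apply: eq_bigr => k _; rewrite expr1n mulr1.
have AE : A = (2 * \sum_(0 <= k < n.+1) P k * (n - k))%N.
  (* The derivative at q = 1 weights each word by its number of ascents. *)
  have /(congr1 (fun p : {poly int} => p^`().[1])) := sum_avoiding ('X : {poly int}) n.
  rewrite /phi !raddf_sum /= !horner_sum => S1.
  apply/eqP; rewrite -eqz_nat; apply/eqP; rewrite -!natz natrM !natr_sum.
  transitivity (2%:R * \sum_(t <- permutations (iota 1 n) | avoiding t)
    ((1 + 'X : {poly int}) ^+ asc t)^`().[1]).
    rewrite big_distrr /=; apply: eq_bigr => t _.
    rewrite deriv_exp hornerMn hornerM horner_exp !hornerE derivD derivX derivC !hornerE /=.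
    by case: asc => [|a]; rewrite ?muln0 ?mulr0n ?mulr0 // natrM natrX exprS -mulrA mulr_natr.
  congr (_ * _); rewrite S1; apply: eq_bigr => k _.
  by rewrite mulr_natl derivMn derivXn !hornerMn hornerXn expr1n -mulrnA mulnC.
suff : (A + 2 * total_blocks n = B)%N by lia.
rewrite AE BE /total_blocks -mulnDr -mulnA; congr (2 * _)%N.
rewrite -big_split big_distrr /=.
by apply: eq_big_nat => k /andP[_ kn] /=; rewrite -/(P k); nia.
Qed.

Lemma w1 : w 1 = 1.
Proof. by rewrite num_chains_weight // /weight big_nat1 /= !big_cons !big_nil. Qed.

Lemma w_values : [seq w n | n <- iota 1 9] =
  [:: 1; 3; 13; 59; 269; 1227; 5613; 25771; 118765]%N.
Proof.
(* Unlike [w], a cardinality over chains, this form of the recurrence evaluates. *)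
pose f := fix f n := if n is n'.+1 then
  (if n' is 0 then 1 else f n' + 2 * sumn [seq k * (paths k 0 * 'C(k, n' - k)) | k <- index_iota 0 n])%N
  else 0%N.
have wf n : (0 < n)%N -> w n = f n.
  elim: n => // -[|n] IH _; first exact: w1.
  transitivity (f n.+1 + 2 * sumn [seq k * (paths k 0 * 'C(k, n.+1 - k)) | k <- index_iota 0 n.+2])%N => //.
  by rewrite w_rec // IH // /total_blocks sumnE big_map.
transitivity [seq f n | n <- iota 1 9]; last by apply/eqP; vm_compute.
by apply/eq_in_map => n; rewrite mem_iota => /andP[n0 _]; apply: wf.
Qed.

(** * Generating function *)

Lemma fps_coefM (a b : fps) n : (a * b) n = \sum_(i < n.+1) a i * b (n - i)%N.
Proof. by []. Qed.

Lemma fps_coefM0 (a b : fps) : (a * b) 0%N = a 0%N * b 0%N.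
Proof. by rewrite fps_coefM big_ord1. Qed.

Lemma fps_coefXM0 (a : fps) : (fpsX * a) 0%N = 0.
Proof. by rewrite fps_coefM0 mul0r. Qed.

Lemma fps_coefXMS (a : fps) n : (fpsX * a) n.+1 = a n.
Proof.
rewrite fps_coefM big_ord_recl mul0r add0r big_ord_recl mul1r subSS subn0.
by rewrite big1 ?addr0 // => i _; rewrite /= mul0r.
Qed.

Lemma fpsXI : injective ( *%R fpsX).
Proof.
by move=> a b ab; apply: fpsP => n; rewrite -[LHS]fps_coefXMS ab fps_coefXMS.
Qed.

Lemma fps_unitE (a : fps) : (a \is a GRing.unit) = (a 0%N != 0).
Proof. by []. Qed.

(** The factor [a + b] of [a^2 - b^2] has constant term 2 and is invertible. *)
Lemma fps_sqr_inj (a b : fps) : a 0%N = 1 -> b 0%N = 1 -> a ^+ 2 = b ^+ 2 -> a = b.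
Proof.
move=> a0 b0 ab; have u : a + b \is a GRing.unit by rewrite fps_unitE /= a0 b0.
by apply/eqP; rewrite -subr_eq0 -(mulIr_eq0 _ (mulIr u)) -subr_sqr ab subrr.
Qed.

(* The Euler operator x d/dx. *)
Definition fps_theta (a : fps) : fps := FPS (fun n => n%:R * a n).

Lemma fps_thetaM a b : fps_theta (a * b) = fps_theta a * b + a * fps_theta b.
Proof.
apply: fpsP => n; rewrite /= -!/(fps_mul _ _ _) /= -big_split big_distrr /=.
apply: eq_bigr => i _; rewrite -[in n%:R](subnK (leq_ord i)) natrD; ring.
Qed.

(* a composed with x + x^2 *)
Definition fps_comp (a : fps) : fps :=
  FPS (fun n => \sum_(0 <= k < n.+1) a k * 'C(k, n - k)%:R).

Lemma coef_1X_exp i j : ((1 + 'X : {poly rat}) ^+ i)`_j = 'C(i, j)%:R.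
Proof.
elim: i j => [|i IH] j; first by rewrite expr0 coef1; case: j.
rewrite exprS mulrDl mul1r coefD coefXM IH; case: j => [|j]; first by rewrite !bin0 addr0.
by rewrite IH binS natrD.
Qed.

Lemma sum_nat_trunc (V : nmodType) (F : nat -> V) a b : (a <= b)%N ->
  (forall k, (a <= k)%N -> F k = 0) -> \sum_(0 <= k < b) F k = \sum_(0 <= k < a) F k.
Proof.
move=> ab F0; rewrite (big_cat_nat _ ab) //= [X in _ + X]big_nat_cond.
by rewrite [X in _ + X]big1 ?addr0 // => k /andP[/andP[/F0]].
Qed.

Lemma coef_comp_polyXX2 (p : {poly rat}) n :
  (p \Po ('X + 'X ^+ 2))`_n = \sum_(0 <= k < n.+1) p`_k * 'C(k, n - k)%:R.
Proof.
(* For [n < k] truncated subtraction would give ['C(k, 0) = 1], whereas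
   [(x + x^2)^k = x^k (1 + x)^k] has no term of degree [n]. *)
pose F k := p`_k * (if (n < k)%N then 0 else 'C(k, n - k)%:R).
rewrite comp_polyE coef_sum; transitivity (\sum_(0 <= k < size p) F k).
  rewrite big_mkord; apply: eq_bigr => k _; rewrite coefZ; congr (_ * _).
  by rewrite (_ : 'X + _ = 'X * (1 + 'X)) ?exprMn ?coefXnM ?coef_1X_exp //; ring.
transitivity (\sum_(0 <= k < n.+1) F k); last first.
  by apply: eq_big_nat => k /andP[_ kn]; rewrite /F ltnNge -ltnS kn.
have Fn k : (n.+1 <= k)%N -> F k = 0 by rewrite /F => ->; rewrite mulr0.
have Fp k : (size p <= k)%N -> F k = 0 by move=> pk; rewrite /F nth_default ?mul0r.
case/orP: (leq_total (size p) n.+1) => pn; last exact: sum_nat_trunc.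
by apply/esym/sum_nat_trunc.
Qed.

Lemma fps_comp_trunc N a n : (n <= N)%N ->
  fps_comp a n = (fps_trunc N a \Po ('X + 'X ^+ 2))`_n.
Proof.
move=> nN; rewrite coef_comp_polyXX2 /=; apply: eq_big_nat => k /andP[_ kn].
by rewrite coef_fps_trunc // (leq_trans _ nN).
Qed.

(** A coefficient depends only on truncations, which reduces the claim to composition of
    polynomials. *)
Lemma fps_compM a b : fps_comp (a * b) = fps_comp a * fps_comp b.
Proof.
apply: fpsP => n; rewrite fps_coefM.
transitivity (((fps_trunc n a * fps_trunc n b) \Po ('X + 'X ^+ 2))`_n).
  rewrite coef_comp_polyXX2; apply: eq_big_nat => k /andP[_ kn].
  by congr (_ * _); apply: fps_mul_trunc.
rewrite comp_polyM coefM; apply: eq_bigr => i _.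
by rewrite -!fps_comp_trunc ?leq_subr // -ltnS.
Qed.

Lemma fps_compD a b : fps_comp (a + b) = fps_comp a + fps_comp b.
Proof. by apply: fpsP => n /=; rewrite -big_split; apply: eq_bigr => k _; rewrite mulrDl. Qed.

Lemma fps_comp1 : fps_comp 1 = 1.
Proof.
apply: fpsP => n /=; rewrite big_nat_recl // big1 => [|k _]; last by rewrite mul0r.
by rewrite addr0 mul1r subn0 bin0n.
Qed.

Lemma fps_compX : fps_comp fpsX = fpsX + fpsX ^+ 2.
Proof.
apply: fpsP => n; rewrite expr2 -[RHS]/(fpsX n + (fpsX * fpsX) n).
case: n => [|n]; first by rewrite fps_coefXM0 /= big_nat1 mul0r addr0.
rewrite fps_coefXMS /= big_nat_recl // mul0r add0r big_nat_recl // mul1r.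
rewrite big1 => [|k _]; last by rewrite mul0r.
by rewrite subSS subn0 addr0; case: n => [|[|n]].
Qed.

(** * The Catalan series and its link with [paths] *)

(** The witness is [(1 - sqrt(1 - 4x)) / (2x)], where [d] is the quotient of [s - 1] by [x]. *)
Lemma fps_sqrt_catalan : exists c : fps, c = 1 + fpsX * c ^+ 2.
Proof.
have s0 : (1 - 4 * fpsX) 0%N = 1 :> rat.
  by rewrite mulrC -[LHS]/(1 - (fpsX * 4) 0%N) fps_coefXM0 subr0.
have := sqr_fps_sqrt s0; set s := fps_sqrt _ => s2.
pose d := FPS (fun n => s n.+1).
have sE : s = 1 + fpsX * d.
  apply: fpsP => n; rewrite -[RHS]/((1 : fps) n + (fpsX * d) n).
  by case: n => [|n]; rewrite ?fps_coefXM0 ?fps_coefXMS ?addr0 ?add0r //= fps_sqrt_coef0.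
have u2 : (2 : fps) \is a GRing.unit by [].
pose h := 2^-1 * d; have dE : d = 2 * h by rewrite mulrA divrr ?mul1r.
exists (- h); apply: (mulrI u2); apply: (mulrI u2); apply: fpsXI.
apply/eqP; rewrite -subr_eq0; apply/eqP.
transitivity (1 - 4 * fpsX - s ^+ 2); last by rewrite s2 subrr.
by rewrite sE dE; ring.
Qed.

Lemma fps_coefXnM_small r (a : fps) k : (k < r)%N -> (fpsX ^+ r * a) k = 0.
Proof.
elim: r k => // r IH [|k] kr; rewrite exprS -mulrA ?fps_coefXM0 ?fps_coefXMS //.
exact: IH.
Qed.

(** Replacing one factor [c] by [1 + x c^2] in [D r = x^r c^(r+1)] gives
    [D (r+1) = x D r + D (r+2)]. Iterated, this is the recursion of [paths]. *)
Lemma paths_catalan (c : fps) k r : c = 1 + fpsX * c ^+ 2 ->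
  (paths k r)%:R = (fpsX ^+ r * c ^+ r.+1) k.
Proof.
move=> cE; pose D r := fpsX ^+ r * c ^+ r.+1; rewrite -/(D r).
have D0 : D 0%N = 1 + D 1%N by rewrite /D expr0 mul1r !expr1 {1}cE.
have DS j : D j.+1 = fpsX * D j + D j.+2.
  rewrite /D [c ^+ j.+2]exprS {1}cE !exprS; ring.
have small j i : (i < j)%N -> D j i = 0 by apply: fps_coefXnM_small.
elim: k r => [|k IH] r.
  case: r => [|r]; last by rewrite small.
  by rewrite D0 -[RHS]/(1 + D 1%N 0%N) small ?addr0.
have {IH} -> : (paths k.+1 r)%:R = \sum_(r.-1 <= i < k.+1) D i k :> rat.
  by rewrite pathsS natr_sum; apply: eq_bigr => i _; apply: IH.
(* Downward induction on [r], starting above [k.+1], where both sides vanish; [r = 0] reduces to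
   [r = 1]. *)
have [j] := ubnP (k.+2 - r); elim: j r => // j IH r rj.
have [kr|rk] := ltnP k.+1 r; first by rewrite small // big_geq //; lia.
case: r rj rk => [|r] rj rk; last first.
  rewrite DS -[RHS]/((fpsX * D r) k.+1 + D r.+2 k.+1) fps_coefXMS big_ltn //.
  by congr (_ + _); apply: (IH r.+2); lia.
rewrite D0 -[RHS]/(0 + D 1%N k.+1) add0r.
by apply: (IH 1%N); lia.
Qed.

Definition catalan : fps := FPS (fun n => (paths n 0)%:R).

Lemma catalanE : catalan = 1 + fpsX * catalan ^+ 2.
Proof.
have [c cE] := fps_sqrt_catalan; suff -> : catalan = c by [].
by apply: fpsP => n; rewrite /= (paths_catalan _ _ cE) expr0 mul1r expr1.
Qed.

Lemma fps_theta_catalan : fps_theta catalan =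
  fpsX * catalan ^+ 2 + 2 * fpsX * catalan * fps_theta catalan.
Proof.
have t1 : fps_theta 1 = 0 by apply: fpsP => -[|n]; rewrite /= ?mul0r ?mulr0.
have tX : fps_theta fpsX = fpsX by apply: fpsP => -[|[|n]]; rewrite /= ?mul0r ?mulr0 ?mulr1.
have tD a b : fps_theta (a + b) = fps_theta a + fps_theta b.
  by apply: fpsP => n /=; rewrite mulrDr.
rewrite {1}catalanE tD t1 add0r fps_thetaM tX expr2 fps_thetaM; ring.
Qed.

(** With [y = x + x^2], the series [C] is the Catalan series at [y] and [K] generates
    [total_blocks], the Euler operator supplying the factor [k]. *)
Lemma one_plus_W :
  1 + W = fpsX / (1 - fpsX ^+ 2) + (1 - 2 * fpsX - 2 * fpsX ^+ 2) /
    ((1 - fpsX ^+ 2) * fps_sqrt (1 - 4 * fpsX - 4 * fpsX ^+ 2)).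
Proof.
pose y : fps := fpsX + fpsX ^+ 2; set r := fps_sqrt _.
pose C := fps_comp catalan; pose K := fps_comp (fps_theta catalan).
have coefX2 a : (fpsX ^+ 2 * a) 0%N = 0 by rewrite fps_coefXnM_small.
have CE : C = 1 + y * C ^+ 2.
  by rewrite /C {1}catalanE fps_compD fps_comp1 fps_compM fps_compX expr2 fps_compM.
have comp2 : fps_comp 2 = 2 by rewrite fps_compD fps_comp1.
have KE : K = y * C ^+ 2 + 2 * y * C * K.
  by rewrite /K {1}fps_theta_catalan fps_compD expr2 !fps_compM comp2 fps_compX.
have y0 a : (y * a) 0%N = 0.
  by rewrite /y mulrDl -[LHS]/((fpsX * a) 0%N + (fpsX ^+ 2 * a) 0%N) fps_coefXM0 coefX2 addr0.
have r4 : 1 - 4 * fpsX - 4 * fpsX ^+ 2 = 1 - y * 4 by rewrite /y; ring.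
have r40 : (1 - 4 * fpsX - 4 * fpsX ^+ 2) 0%N = 1 :> rat.
  by rewrite r4 -[LHS]/(1 - (y * 4) 0%N) y0 subr0.
(* Solving the quadratic equation of [C]; constant term 1 selects the root. *)
have rE : r = 1 - 2 * y * C.
  apply: fps_sqr_inj; first exact: fps_sqrt_coef0.
    have -> : 2 * y * C = y * (2 * C) by ring.
    by rewrite -[LHS]/(1 - (y * (2 * C)) 0%N) y0 subr0.
  rewrite sqr_fps_sqrt // r4; apply/eqP; rewrite -subr_eq0; apply/eqP.
  transitivity (4 * y * (C - (1 + y * C ^+ 2))); first by ring.
  by rewrite -CE subrr mulr0.
have Kr : K * r = C - 1.
  rewrite rE; transitivity ((K - (y * C ^+ 2 + 2 * y * C * K)) + (1 + y * C ^+ 2) - 1); first by ring.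
  by rewrite -KE -CE subrr add0r.
(* This is [w_rec]; the added 1 extends it to [n = 0], where [w 1 = 1] and there are no blocks. *)
have WK : (1 - fpsX) * (1 + W) = 1 + fpsX * (2 * K).
  apply: fpsP => n; rewrite mulrBl mul1r.
  rewrite -[LHS]/((1 : fps) n + W n - (fpsX * (1 + W)) n) -[RHS]/((1 : fps) n + (fpsX * (2 * K)) n).
  case: n => [|n]; first by rewrite [(fpsX * _) 0%N]fps_coefXM0 [(fpsX * (2 * K)) 0%N]fps_coefXM0 subr0.
  rewrite !fps_coefXMS -[(2 * K) n]/(((1 + 1) * K) n) mulrDl !mul1r.
  rewrite -[(K + K) n]/(K n + K n) -[(1 + W) n]/((1 : fps) n + W n) /= !add0r.
  have -> : \sum_(0 <= k < n.+1) k%:R * (paths k 0)%:R * 'C(k, n - k)%:R = (total_blocks n)%:R :> rat.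
    by rewrite natr_sum; apply: eq_bigr => k _; rewrite !natrM mulrA.
  case: n => [|n]; first by rewrite w1 /total_blocks big_nat1 mul0n !addr0 subrr.
  by rewrite w_rec // natrD natrM /=; ring.
have u1 (a : fps) : a 0%N = 0 -> (1 - a) \is a GRing.unit.
  by move=> a0; rewrite fps_unitE -[(1 - a) 0%N]/(1 - a 0%N) a0 subr0.
have ur : r \is a GRing.unit by rewrite fps_unitE fps_sqrt_coef0.
have uX2 : 1 - fpsX ^+ 2 \is a GRing.unit by apply: u1; rewrite expr2 fps_coefXM0.
apply: (mulrI uX2); apply: (mulrI ur).
have -> : r * ((1 - fpsX ^+ 2) * (1 + W)) = fpsX * r + (1 - 2 * fpsX - 2 * fpsX ^+ 2).
  (* The factor [1 + x] turns the [x] before [K] into [y], so that [2 y C = 1 - r] applies. *)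
  transitivity ((1 + fpsX) * r * ((1 - fpsX) * (1 + W))); first by ring.
  rewrite WK; transitivity ((1 + fpsX) * r + 2 * y * (K * r)); first by rewrite /y; ring.
  by rewrite Kr rE /y; ring.
rewrite !mulrDr; congr (_ + _).
  by rewrite [(1 - fpsX ^+ 2) * _]mulrC divrK // mulrC.
by rewrite mulrA [r * _]mulrC [RHS]mulrC divrK // unitrM uX2 ur.
Qed.

Theorem theorem7 :
  [/\ forall n : nat, (0 < n)%N ->
        w n = (\sum_(0 <= d < n) 2 ^ (n - 1 - d) * e n d +
               \sum_(3 <= j < n.+1) \sum_(0 <= d < (j - 3).+1)
                  2 ^ (j - 1 - d) * g j d)%N,
      [seq w n | n <- iota 1 9] =
        [:: 1; 3; 13; 59; 269; 1227; 5613; 25771; 118765]%N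
    & let X := fpsX in
      1 + W = X / (1 - X ^+ 2) +
              (1 - 2 * X - 2 * X ^+ 2) /
                ((1 - X ^+ 2) * fps_sqrt (1 - 4 * X - 4 * X ^+ 2))].
Proof. by split; [exact: w_descents | exact: w_values | exact: one_plus_W]. Qed.
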